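(* Let $J\subset\mathbb R$ be a compact interval with nonempty interior and let $\varepsilon>0$ be computable. Assume there is a fixed computable point $x_0\in J$ whose fixed approximant sequence $n\mapsto r_n(\{x_0\})$ is computable. Equip the diagonal singleton instance spaces with the evaluation-name representations. Then $$\mathcal P^\sigma_{J,\mathrm{diag}}\equiv_{\mathrm{TTE},\mathrm{fq}}\mathcal P^{\sigma_\varepsilon}_{J,\varepsilon,\mathrm{diag}}.$$ Consequently, the same two problems are also equivalent in the continuous and raw modalities: $\mathcal P^\sigma_{J,\mathrm{diag}}\equiv_{\mathrm{cont},\mathrm{fq}}\mathcal P^{\sigma_\varepsilon}_{J,\varepsilon,\mathrm{diag}}$ and $\mathcal P^\sigma_{J,\mathrm{diag}}\equiv_{\mathrm{raw},\mathrm{fq}}\mathcal P^{\sigma_\varepsilon}_{J,\varepsilon,\mathrm{diag}}$.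
   Context: $\mathbb N=\{1,2,\dots\}$, $\mathbb N_0=\{0,1,2,\dots\}$. Problems. $\Omega_{\mathrm{diag}}$ is the class of maximal closed diagonal operators on $\ell^2(\mathbb N)$: for a sequence $(a_j)_{j\in\mathbb N}\subset\mathbb C$, $\mathcal D(A)=\{x\in\ell^2(\mathbb N):(a_jx_j)_j\in\ell^2(\mathbb N)\}$, $(Ax)_j=a_jx_j$. $\mathcal K_{\mathrm{sgl}}(J)=\{\{z\}:z\in J\}$; for each $K=\{z\}$ approximants $r_n(K)\in\mathbb Q+i\mathbb Q$, $n\in\mathbb N$, with $|r_n(K)-z|\le2^{-(n+1)}$ are fixed. The interface is $\Lambda_{\mathrm{diag}}=\{\mu_j:j\in\mathbb N\}\cup\{\rho_n:n\in\mathbb N\}$ (effectively indexed in the obvious way), $\mu_j(A,K)=a_j$ where $Ae_j=a_je_j$, $\rho_n(A,K)=r_n(K)$, with values in $\mathbb C$. $\sigma_\varepsilon(A)=\overline{\{z\in\mathbb C:\|(A-zI)^{-1}\|>\varepsilon^{-1}\}}$ (norm $=\infty$ on $\sigma(A)$). $\mathcal P^{\sigma}_{J,\mathrm{diag}}$ has instance set $\Omega_{\mathrm{diag}}\times\mathcal K_{\mathrm{sgl}}(J)$, interface $\Lambda_{\mathrm{diag}}$, output space $\{0,1\}$ (discrete) and target $1$ if $\sigma(A)\cap K=\varnothing$, $0$ otherwise; $\mathcal P^{\sigma_\varepsilon}_{J,\varepsilon,\mathrm{diag}}$ is the same with target $1$ if $\sigma_\varepsilon(A)\cap K=\varnothing$,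 $0$ otherwise. Representations. $\mathbb C,\mathbb R,\mathbb N,\{0,1\}$ carry their standard representations. In the evaluation-name representation of $\Omega_{\mathrm{diag}}\times\mathcal K_{\mathrm{sgl}}(J)$ a name of $(A,K)$ is an oracle which uniformly in $j,n$ computes names of all $\mu_j(A,K)$ and $\rho_n(A,K)$ (i.e. a name of the evaluation table). Transports. Let $\mathcal S=(\Psi,\Sigma,\mathcal N,\Lambda_{\mathcal S})$ and $\mathcal P=(\Xi,\Omega,\mathcal M,\Lambda_{\mathcal P})$ (target map, instance set, metric output space, evaluations with value spaces $V_f$). A finite-query transport from $\mathcal S$ to $\mathcal P$ consists of $E:\Sigma\to\Omega$, $D:\mathcal M\to\mathcal N$ with $D(\Xi(E(x)))=\Psi(x)$ for all $x\in\Sigma$ and, for each $f\in\Lambda_{\mathcal P}$, some $m_f\in\mathbb N_0$, $\gamma_{f,1},\dots,\gamma_{f,m_f}\in\Lambda_{\mathcal S}$ and a map $\vartheta_f$ from the joint image of $(\gamma_{f,1},\dots,\gamma_{f,m_f})$ (one point if $m_f=0$) to $V_f$ with $f(E(x))=\vartheta_f(\gamma_{f,1}(x),\dots,\gamma_{f,m_f}(x))$ for all $x\in\Sigma$. - $\mathcal S\le_{\mathrm{raw},\mathrm{fq}}\mathcal P$: such a transport with $D$ continuous exists. - $\mathcal S\le_{\mathrm{cont},\mathrm{fq}}\mathcal P$: one with $E$ (initial topologies of the evaluations), $D$ and all $\vartheta_f$ continuous exists. - $\mathcal S\le_{\mathrm{TTE},\mathrm{fq}}\mathcal P$: one exists with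 $E$ and $D$ having computable realizers and such that, uniformly in a code of $f$, one can compute $m_f$, codes of $\gamma_{f,1},\dots,\gamma_{f,m_f}$, and an index of a computable partial map $\widehat\vartheta_f:\subseteq V_{\gamma_{f,1}}\times\cdots\times V_{\gamma_{f,m_f}}\to V_f$ whose domain contains the joint image and which restricts to $\vartheta_f$ there. In each case $\equiv$ denotes mutual reducibility. *)

(* Defs.v *)
(* Sequences indexed by {1,2,...} are represented by functions on [nat], the
   natural number [j] standing for the index [j + 1]. *)
From HB Require Import structures.
From mathcomp Require Import all_boot all_order all_algebra.
From mathcomp Require Import complex.
From mathcomp Require Import all_classical all_reals all_analysis.
From Stdlib Require Cantor.

Set Implicit Arguments.
Unset Strict Implicit.
Unset Printing Implicit Defensive.

Import Order.TTheory GRing.Theory Num.Theory numFieldNormedType.Exports.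
Import ComplexField.Normc.

Local Open Scope classical_set_scope.
Local Open Scope ring_scope.
Local Open Scope complex_scope.

Definition npair (x y : nat) : nat := Cantor.to_nat (x, y).
Definition nfst (n : nat) : nat := (Cantor.of_nat n).1.
Definition nsnd (n : nat) : nat := (Cantor.of_nat n).2.

(* Partial recursive functions with an oracle; every program takes one natural
   number as input, several arguments being paired with [npair]. *)
Inductive code :=
| CZero
| CSucc
| CFst
| CSnd
| COracle
| CPair (a b : code)
| CComp (a b : code)
| CRec (a b : code)
| CMin (a : code).

(* [eval p c x y]: program [c] with oracle [p] halts on input [x], output [y] *)
Fixpoint eval (p : nat -> nat) (c : code) : nat -> nat -> Prop :=
  match c with
  | CZero => fun _ y => y = 0%N
  | CSucc => fun x y => y = x.+1
  | CFst => fun x y => y = nfst x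
  | CSnd => fun x y => y = nsnd x
  | COracle => fun x y => y = p x
  | CPair a b => fun x y =>
      exists u v, [/\ eval p a x u, eval p b x v & y = npair u v]
  | CComp a b => fun x y => exists2 u, eval p b x u & eval p a u y
  | CRec a b => fun x y => exists s : nat -> nat,
      [/\ eval p a (nfst x) (s 0%N),
          forall i, (i < nsnd x)%N ->
            eval p b (npair (nfst x) (npair i (s i))) (s i.+1)
        & y = s (nsnd x)]
  | CMin a => fun x y =>
      eval p a (npair x y) 0%N /\
      forall i, (i < y)%N -> exists u, eval p a (npair x i) u.+1
  end.

Fixpoint encode (c : code) : nat :=
  match c with
  | CZero => npair 0 0
  | CSucc => npair 1 0
  | CFst => npair 2 0
  | CSnd => npair 3 0
  | COracle => npair 4 0
  | CPair a b => npair 5 (npair (encode a) (encode b))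
  | CComp a b => npair 6 (npair (encode a) (encode b))
  | CRec a b => npair 7 (npair (encode a) (encode b))
  | CMin a => npair 8 (encode a)
  end.

Definition eval0 (c : code) : nat -> nat -> Prop := eval (fun=> 0%N) c.

(* [d p x] means that [p] is a name of [x] *)
Definition rep (X : Type) := (nat -> nat) -> X -> Prop.

Definition section (p : nat -> nat) (i : nat) : nat -> nat :=
  fun k => p (npair i k).

(* [c] realizes the partial map [F] with domain [A]; the values of [F] outside
   [A] are irrelevant *)
Definition realizes (X Y : Type) (dX : rep X) (dY : rep Y) (c : code)
    (A : set X) (F : X -> Y) : Prop :=
  forall p x, dX p x -> A x ->
    exists2 q, dY q (F x) & forall n, eval p c n (q n).

Definition computable_map (X Y : Type) (dX : rep X) (dY : rep Y) (F : X -> Y) :=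
  exists c, realizes dX dY c setT F.

Definition computable_pt (X : Type) (d : rep X) (x : X) : Prop :=
  exists c p, (forall n, eval0 c n (p n)) /\ d p x.

Definition computable_seq (X : Type) (d : rep X) (u : nat -> X) : Prop :=
  exists c p, (forall n, eval0 c n (p n)) /\ forall n, d (section p n) (u n).

Definition tuple_rep (m : nat) (V : 'I_m -> Type) (d : forall k, rep (V k)) :
    rep (forall k, V k) :=
  fun p v => forall k : 'I_m, d k (section p k) (v k).

Definition bool_rep : rep bool := fun p b => p 0%N = b.

(* the notation <i,<j,k>> |-> (i - j) / (k + 1) of the rational numbers *)
Definition nuQ (R : realType) (n : nat) : R :=
  ((nfst n)%:R - (nfst (nsnd n))%:R) / (nsnd (nsnd n)).+1%:R.

Definition real_rep (R : realType) : rep R :=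
  fun p x => forall k, `|nuQ R (p k) - x| <= 2 ^- k.

(* [R[i]^o] is [R[i]] with its topology *)
Notation CC R := (R[i]^o).

Definition complex_rep (R : realType) : rep (CC R) :=
  fun p z => forall k,
    normc (nuQ R (nfst (p k)) +i* nuQ R (nsnd (p k)) - z : R[i]) <= 2 ^- k.

Record problem (R : realType) := Problem {
  inst : choiceType;
  out : metricType R;
  idx : Type;
  val_of : idx -> topologicalType;
  ev : forall f : idx, inst -> val_of f;
  target : inst -> out }.

Arguments ev {R} p f x.
Arguments target {R} p x.
Arguments val_of {R} p f.

Definition table (R : realType) (P : problem R) (x : inst P) :
    prod_topology (val_of P) := fun f => ev P f x.

(* The initial topology of the family of all evaluations *)
Definition inst_top (R : realType) (P : problem R) : topologicalType :=
  initial_topology (@table R P).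

(* [ttheta f] matters only on the joint image of the queries of [f] *)
Record transport (R : realType) (S P : problem R) := Transport {
  tE : inst S -> inst P;
  tD : out P -> out S;
  tm : idx P -> nat;
  tquery : forall f : idx P, 'I_(tm f) -> idx S;
  ttheta : forall f : idx P,
    prod_topology (fun k : 'I_(tm f) => val_of S (tquery k)) -> val_of P f;
  t_target : forall x, tD (target P (tE x)) = target S x;
  t_ev : forall f x, ev P f (tE x) = ttheta (fun k => ev S (tquery k) x) }.

Arguments tE {R S P} t x.
Arguments tD {R S P} t y.
Arguments tm {R S P} t f.
Arguments tquery {R S P} t f k.
Arguments ttheta {R S P} t f v.

Definition joint_image (R : realType) (S P : problem R) (t : transport S P)
    (f : idx P) : set (prod_topology (fun k => val_of S (tquery t f k))) :=
  range (fun x k => ev S (tquery t f k) x).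

Arguments joint_image {R S P} t f _.

Definition le_raw (R : realType) (S P : problem R) : Prop :=
  exists t : transport S P, continuous (tD t).

Definition le_cont (R : realType) (S P : problem R) : Prop :=
  exists t : transport S P,
    [/\ continuous (tE t : inst_top S -> inst_top P),
        continuous (tD t)
      & forall f, {within joint_image t f, continuous (ttheta t f)}].

Record rep_problem (R : realType) := RepProblem {
  prob :> problem R;
  idx_code : idx prob -> nat;
  idx_code_inj : injective idx_code;
  inst_rep : rep (inst prob);
  out_rep : rep (out prob);
  val_rep : forall f : idx prob, rep (val_of prob f) }.

Arguments idx_code {R} r f.
Arguments inst_rep {R} r p x.
Arguments out_rep {R} r p y.
Arguments val_rep {R} r f p v.

Definition evaluation_names (R : realType) (P : problem R)
    (cd : idx P -> nat) (d : forall f, rep (val_of P f)) : rep (inst P) :=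
  fun p x => forall f, d f (section p (cd f)) (ev P f x).

Definition le_TTE (R : realType) (S P : rep_problem R) : Prop :=
  exists t : transport S P,
    [/\ computable_map (inst_rep S) (inst_rep P) (tE t),
        computable_map (out_rep P) (out_rep S) (tD t)
      & exists cm cq ct : code, forall f : idx P,
        [/\ eval0 cm (idx_code P f) (tm t f),
            forall k : 'I_(tm t f),
              eval0 cq (npair (idx_code P f) k) (idx_code S (tquery t f k))
          & exists2 e : code, eval0 ct (idx_code P f) (encode e) &
            exists dom th,
              [/\ joint_image t f `<=` dom,
                  {in joint_image t f, th =1 ttheta t f}
                & realizes (tuple_rep (fun k => val_rep S (tquery t f k)))
                    (val_rep P f) e dom th]]].

Definition equiv_raw (R : realType) (S P : problem R) :=
  le_raw S P /\ le_raw P S.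
Definition equiv_cont (R : realType) (S P : problem R) :=
  le_cont S P /\ le_cont P S.
Definition equiv_TTE (R : realType) (S P : rep_problem R) :=
  le_TTE S P /\ le_TTE P S.

Definition bit (R : realType) : Type := bool.

Section Bit.
Variable R : realType.

Let dist (x y : bit R) : R := ((x : bool) != y)%:R.

Let dist_xx x : dist x x = 0. Proof. by rewrite /dist eqxx. Qed.

Let dist_pos x y : dist x y = 0 -> x = y.
Proof.
by rewrite /dist; case: eqVneq => //= _ /eqP; rewrite oner_eq0.
Qed.

Let dist_sym x y : dist x y = dist y x. Proof. by rewrite /dist eq_sym. Qed.

Let dist_triangle y x z : dist x z <= dist x y + dist y z.
Proof. by rewrite /dist -natrD ler_nat; case: x y z => [] [] []. Qed.

HB.instance Definition _ := Choice.copy (bit R) bool.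
HB.instance Definition _ :=
  @isMetric.Build R (bit R) dist dist_xx dist_pos dist_sym dist_triangle.

End Bit.

Section Operators.
Variable R : realType.
Local Notation C := (CC R).

Definition vec := nat -> C.

Definition ell2 : set vec :=
  [set x | cvgn (series (fun j => normc (x j) ^+ 2))].

Definition norm2 (x : vec) : R :=
  Num.sqrt (limn (series (fun j => normc (x j) ^+ 2))).

Definition basis (j : nat) : vec := fun i => (i == j)%:R.

(* An unbounded operator is identified with its graph, a set of pairs of
   elements of [ell2]. *)
Definition operator := set (vec * vec).

Definition shift (A : operator) (z : C) : operator :=
  [set u | exists2 w, A (u.1, w) & u.2 = (fun j => w j - z * u.1 j)].

Definition inverse (A : operator) : operator := [set u | A (u.2, u.1)].

Definition bounded (A : operator) : Prop :=
  exists M : R, forall u, A u -> norm2 u.2 <= M * norm2 u.1.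

Definition opnorm (A : operator) : \bar R :=
  ereal_sup [set (norm2 u.2)%:E | u in [set u | A u /\ norm2 u.1 <= 1]].

Definition resolvent_set (A : operator) : set C :=
  [set z | (forall y, ell2 y -> exists! x, shift A z (x, y)) /\
           bounded (inverse (shift A z))].

Definition spectrum (A : operator) : set C := ~` resolvent_set A.

Definition resolvent_norm (A : operator) (z : C) : \bar R :=
  if `[< spectrum A z >] then +oo%E else opnorm (inverse (shift A z)).

Definition pseudospectrum (eps : R) (A : operator) : set C :=
  closure [set z | ((eps^-1)%:E < resolvent_norm A z)%E].

Definition diag (a : nat -> C) : operator :=
  [set u | [/\ ell2 u.1, ell2 (fun j => a j * u.1 j)
             & u.2 = (fun j => a j * u.1 j)]].

Definition Omega_diag : set operator := [set A | exists a, A = diag a].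

Definition K_sgl (J : set R) : set (set C) :=
  [set K | exists2 x, J x & K = [set (x%:C : C)]].

Definition gauss (q : rat * rat) : C := ratr q.1 +i* ratr q.2.

(* The bound is 2^-(m+1) for the index m = n + 1; the values of [r] outside
   [K_sgl J] are irrelevant. *)
Definition approximants (J : set R) (r : set C -> nat -> rat * rat) : Prop :=
  forall x, J x -> forall n,
    normc (gauss (r [set (x%:C : C)] n) - x%:C : R[i]) <= 2 ^- n.+2.

Definition inst_diag (J : set R) : choiceType :=
  (Omega_diag `*` K_sgl J : set (operator * set C)).

(* The eigenvalue of [A] at the j-th basis vector; unique when [A] is diagonal *)
Definition mu (j : nat) (A : operator) : C :=
  xget 0 [set a : C | A (basis j, fun i => a * basis j i)].

Definition ev_diag (J : set R) (r : set C -> nat -> rat * rat)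
    (f : nat + nat) (x : inst_diag J) : C :=
  match f with
  | inl j => mu j (val x).1
  | inr n => gauss (r (val x).2 n)
  end.

Definition code_diag (f : nat + nat) : nat :=
  match f with inl j => j.*2 | inr n => n.*2.+1 end.

Lemma code_diag_inj : injective code_diag.
Proof.
move=> [i|i] [j|j] /= e.
- by congr inl; apply: double_inj.
- by move: (congr1 odd e); rewrite /= !odd_double.
- by move: (congr1 odd e); rewrite /= !odd_double.
- by congr inr; apply: double_inj; case: e.
Qed.

Definition diag_problem (spec : operator -> set C) (J : set R)
    (r : set C -> nat -> rat * rat) : problem R :=
  @Problem R (inst_diag J) (bit R) (nat + nat)%type (fun=> C) (@ev_diag J r)
    (fun x => `[< spec (val x).1 `&` (val x).2 = set0 >]).

Definition diag_rep_problem (spec : operator -> set C) (J : set R)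
    (r : set C -> nat -> rat * rat) : rep_problem R :=
  @RepProblem R (diag_problem spec J r) code_diag code_diag_inj
    (@evaluation_names R (diag_problem spec J r) code_diag
       (fun=> @complex_rep R))
    bool_rep (fun=> @complex_rep R).

Definition P_sigma (J : set R) r := diag_rep_problem spectrum J r.
Definition P_sigma_eps (J : set R) (eps : R) r :=
  diag_rep_problem (pseudospectrum eps) J r.

End Operators.

(* Main.v *)
Require Import Defs.
From mathcomp Require Import all_boot all_order all_algebra.
From mathcomp Require Import complex.
From mathcomp Require Import all_classical all_reals all_analysis.
From mathcomp Require Import ring lra.
From Stdlib Require Cantor.
Import Order.TTheory GRing.Theory Num.Theory numFieldNormedType.Exports.
Import ComplexField.Normc.
Import Defs.

(** A single construction gives both reductions. For a diagonal operator [A]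
    with entries [a], a point [z] lies in the spectrum iff the distances from
    [z] to the entries have infimum 0, and in the pseudospectrum for [eps] iff
    this infimum is at most [eps] ([spectrum_diagP], [pseudospectrum_diagP]).
    Both conditions say that [z] is approached within a radius: 0 or [eps]. So
    it is enough to turn, for computable radii [s] and [tau], the question
    whether [z] is approached within [s] by the entries of [A] into the question
    whether the fixed computable point [x0] is approached within [tau] by the
    entries of a new diagonal operator.

    The new entries are [x0 + tau + t k] with real numbers [t k >= 0], at
    distance [tau + t k] from [x0]; they work as soon as the infimum of [t] is 0
    exactly when the distances from [z] to the entries of [A] have infimum at
    most [s]. Each [t k] may use only finitely many evaluations, hence an entry
    [a j] and an approximation [b n] of [z] but never [z] itself; it must depend
    continuously on them and be computable from names. To avoid computing square
    roots and products of real numbers, the index [k] also carries rational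
    guesses: [q] for [a j], [w] for [z] and [e] for [s]. Then [t k] adds up the
    errors of the guesses, measured by absolute values of coordinates, the term
    [1 / (n + 1)], which exceeds the error of [b n], and a penalty that is 0 if
    [|q - w| <= |e|] and at least 1 otherwise. The comparison with the radius
    thus concerns rational numbers only and is decided exactly, while the
    dependence on [a j] and [b n] is Lipschitz. That the infimum of [t] has the
    required meaning is [excess_small]; [gadget_target] transfers it to the
    problems.

    The remaining work is computability: one function on natural numbers
    ([entry_code]) maps approximations of [a j] and [b n] to an approximation of
    the new evaluation, and serves both for the realizer of the map between
    instances and, by the s-m-n theorem, for the programs of the maps between
    evaluations ([gadget_le_TTE]). Continuity of the latter maps gives the
    continuous reduction ([gadget_le_cont]), which contains the raw one. *)

Set Implicit Arguments.
Unset Strict Implicit.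
Unset Printing Implicit Defensive.

Local Open Scope classical_set_scope.
Local Open Scope ring_scope.
Local Open Scope complex_scope.
Local Notation Re := complex.Re.
Local Notation Im := complex.Im.

(** * Total functions computable from an oracle *)

Arguments npair : simpl never.
Arguments nfst : simpl never.
Arguments nsnd : simpl never.

Lemma nfst_npair x y : nfst (npair x y) = x.
Proof. by rewrite /nfst /npair Cantor.cancel_of_to. Qed.

Lemma nsnd_npair x y : nsnd (npair x y) = y.
Proof. by rewrite /nsnd /npair Cantor.cancel_of_to. Qed.

Lemma npair_eta n : npair (nfst n) (nsnd n) = n.
Proof.
by rewrite /nfst /nsnd /npair -surjective_pairing Cantor.cancel_to_of.
Qed.

Definition npairK := (nfst_npair, nsnd_npair).

(** Total functionals form a class closed under composition and primitive
    recursion, so that programs need not be written by hand. *)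
Definition computable (f : (nat -> nat) -> nat -> nat) :=
  exists c, forall p x, eval p c x (f p x).

Lemma eq_computable f g :
  (forall p x, f p x = g p x) -> computable f -> computable g.
Proof. by move=> fg [c cP]; exists c => p x; rewrite -fg. Qed.

Fixpoint const_code (k : nat) : code :=
  if k is k'.+1 then CComp CSucc (const_code k') else CZero.

Lemma const_codeP p k x : eval p (const_code k) x k.
Proof. by elim: k => //= k IH; exists k. Qed.

Lemma computable_const k : computable (fun _ _ => k).
Proof. by exists (const_code k) => p x; exact: const_codeP. Qed.

Definition id_code := CPair CFst CSnd.

Lemma id_codeP p x : eval p id_code x x.
Proof. by exists (nfst x), (nsnd x); rewrite npair_eta. Qed.

Lemma computable_id : computable (fun _ x => x).
Proof. by exists id_code => p x; exact: id_codeP. Qed.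

Lemma computable_comp f g : computable f -> computable g ->
  computable (fun p x => f p (g p x)).
Proof. by move=> [a aP] [b bP]; exists (CComp a b) => p x; exists (g p x). Qed.

Lemma computable_fst f : computable f -> computable (fun p x => nfst (f p x)).
Proof. by apply: (@computable_comp (fun _ x => nfst x)); exists CFst. Qed.

Lemma computable_snd f : computable f -> computable (fun p x => nsnd (f p x)).
Proof. by apply: (@computable_comp (fun _ x => nsnd x)); exists CSnd. Qed.

Lemma computable_succ f : computable f -> computable (fun p x => (f p x).+1).
Proof. by apply: (@computable_comp (fun _ x => x.+1)); exists CSucc. Qed.

Lemma computable_oracle f : computable f -> computable (fun p x => p (f p x)).
Proof. by apply: (@computable_comp (fun p x => p x)); exists COracle. Qed.

Lemma computable_pair f g : computable f -> computable g ->
  computable (fun p x => npair (f p x) (g p x)).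
Proof.
move=> [a aP] [b bP]; exists (CPair a b) => p x.
by exists (f p x), (g p x).
Qed.

Lemma computable_iteri n h a :
  computable n -> computable h -> computable a ->
  computable (fun p x =>
    iteri (n p x) (fun i y => h p (npair x (npair i y))) (a p x)).
Proof.
move=> [cn nP] [ch hP] [ca aP].
exists (CComp (CRec ca ch) (CPair id_code cn)) => p x.
exists (npair x (n p x)).
  by exists x, (n p x); split=> //; exact: id_codeP.
exists (fun k => iteri k (fun i y => h p (npair x (npair i y))) (a p x)).
by rewrite !npairK; split.
Qed.

Lemma computable_add f g : computable f -> computable g ->
  computable (fun p x => (f p x + g p x)%N).
Proof.
move=> cf cg.
apply: (@eq_computable (fun p x => iteri (f p x)
  (fun i y => (nsnd (nsnd (npair x (npair i y)))).+1) (g p x))).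
  by move=> p x; elim: (f p x) => //= n ->; rewrite !npairK.
apply: (@computable_iteri f (fun _ z => (nsnd (nsnd z)).+1)) => //.
by apply/computable_succ/computable_snd/computable_snd/computable_id.
Qed.

Lemma computable_mul f g : computable f -> computable g ->
  computable (fun p x => (f p x * g p x)%N).
Proof.
move=> cf cg.
apply: (@eq_computable (fun p x => iteri (f p x) (fun i y =>
  let z := npair x (npair i y) in (g p (nfst z) + nsnd (nsnd z))%N) 0%N)).
  by move=> p x; elim: (f p x) => //= n ->; rewrite !npairK mulSn.
apply: (@computable_iteri f (fun p z => g p (nfst z) + nsnd (nsnd z))%N) => //.
  apply: computable_add.
    by apply: computable_comp => //; apply/computable_fst/computable_id.
  by apply/computable_snd/computable_snd/computable_id.
exact: computable_const.
Qed.

Lemma computable_pred f : computable f -> computable (fun p x => (f p x).-1).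
Proof.
move=> cf.
apply: (@eq_computable (fun p x => iteri (f p x) (fun i y =>
  nfst (nsnd (npair x (npair i y)))) 0%N)).
  by move=> p x; case: (f p x) => //= n; rewrite !npairK.
apply: (@computable_iteri f (fun _ z => nfst (nsnd z))) => //.
  by apply/computable_fst/computable_snd/computable_id.
exact: computable_const.
Qed.

Lemma computable_sub f g : computable f -> computable g ->
  computable (fun p x => (f p x - g p x)%N).
Proof.
move=> cf cg.
apply: (@eq_computable (fun p x => iteri (g p x) (fun i y =>
  (nsnd (nsnd (npair x (npair i y)))).-1) (f p x))).
  by move=> p x; elim: (g p x) => [|n] /=; rewrite ?subn0// npairK subnS => ->;
     rewrite npairK.
apply: (@computable_iteri g (fun _ z => (nsnd (nsnd z)).-1)) => //.
by apply/computable_pred/computable_snd/computable_snd/computable_id.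
Qed.

Lemma computable_odd f : computable f ->
  computable (fun p x => odd (f p x) : nat).
Proof.
move=> cf.
apply: (@eq_computable (fun p x => iteri (f p x) (fun i y =>
  (1 - nsnd (nsnd (npair x (npair i y))))%N) 0%N)).
  by move=> p x; elim: (f p x) => //= n ->; rewrite !npairK; case: odd.
apply: (@computable_iteri f (fun _ z => (1 - nsnd (nsnd z))%N)) => //.
  apply: computable_sub; first exact: computable_const.
  by apply/computable_snd/computable_snd/computable_id.
exact: computable_const.
Qed.

Lemma computable_half f : computable f -> computable (fun p x => (f p x)./2).
Proof.
move=> cf.
apply: (@eq_computable (fun p x => iteri (f p x) (fun i y =>
  let z := npair x (npair i y) in
  (odd (nfst (nsnd z)) + nsnd (nsnd z))%N) 0%N)).
  move=> p x; elim: (f p x) => //= n ->.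
  by rewrite !npairK uphalf_half.
apply: (@computable_iteri f
  (fun _ z => (odd (nfst (nsnd z)) + nsnd (nsnd z))%N)) => //.
  apply: computable_add.
    by apply/computable_odd/computable_fst/computable_snd/computable_id.
  by apply/computable_snd/computable_snd/computable_id.
exact: computable_const.
Qed.

Lemma computable_if (b : (nat -> nat) -> nat -> bool) f g :
  computable (fun p x => b p x : nat) -> computable f -> computable g ->
  computable (fun p x => if b p x then f p x else g p x).
Proof.
move=> cb cf cg.
apply: (@eq_computable (fun p x => b p x * f p x + (1 - b p x) * g p x)%N).
  by move=> p x; case: (b p x); rewrite !(mul1n, mul0n, addn0).
apply: computable_add; apply: computable_mul => //.
by apply: computable_sub => //; exact: computable_const.
Qed.

(** The programs given for constants run with the zero oracle; inside a realizer
    they must give the same results under the oracle that names its argument. *)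
Fixpoint forget_oracle (c : code) : code :=
  match c with
  | COracle => CZero
  | CPair a b => CPair (forget_oracle a) (forget_oracle b)
  | CComp a b => CComp (forget_oracle a) (forget_oracle b)
  | CRec a b => CRec (forget_oracle a) (forget_oracle b)
  | CMin a => CMin (forget_oracle a)
  | _ => c
  end.

Lemma eval_forget_oracle p c : eval p (forget_oracle c) = eval0 c.
Proof.
rewrite /eval0; elim: c => //= [a -> b ->|a -> b ->|a -> b ->|a ->] //.
Qed.

Lemma computable_eval0 c q f :
  (forall n, eval0 c n (q n)) -> computable f ->
  computable (fun p x => q (f p x)).
Proof.
move=> cP; apply: (@computable_comp (fun _ => q)).
by exists (forget_oracle c) => p x; rewrite eval_forget_oracle.
Qed.

(** The s-m-n theorem: the program with first argument [k] is the given
    one preceded by the constant [k], whose code is primitive recursive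
    in [k]. *)
Lemma computable_smn f : computable f -> exists ct, forall k,
  exists2 e, eval0 ct k (encode e) & forall p x, eval p e x (f p (npair k x)).
Proof.
move=> [c cP].
pose spec k := CComp c (CPair (const_code k) id_code).
suff [ct ctP] : computable (fun _ k => encode (spec k)).
  exists ct => k; exists (spec k) => [|p x]; first exact: ctP.
  exists (npair k x) => //; exists k, x.
  by split=> //; [exact: const_codeP | exact: id_codeP].
have cconst : computable (fun _ k => encode (const_code k)).
  apply: (@eq_computable (fun p x => iteri x (fun i y =>
    npair 6 (npair (encode CSucc) (nsnd (nsnd (npair x (npair i y))))))
    (encode CZero))).
    move=> _ x.
    pose h := fun _ y : nat => npair 6 (npair (encode CSucc) y).
    rewrite (@eq_iteri _ _ h) => [|i y]; last by rewrite !npairK.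
    by elim: x => //= n ->.
  apply: (@computable_iteri (fun _ x => x)
    (fun _ z => npair 6 (npair (encode CSucc) (nsnd (nsnd z))))).
  - exact: computable_id.
  - do 2!(apply: computable_pair; first exact: computable_const).
    by apply/computable_snd/computable_snd/computable_id.
  - exact: computable_const.
apply: computable_pair; first exact: computable_const.
apply: computable_pair; first exact: computable_const.
apply: computable_pair; first exact: computable_const.
by apply: computable_pair => //; exact: computable_const.
Qed.

(** * Arithmetic on notations of rational numbers *)

(** Notations are not reduced: [qmk i j d] denotes [(i - j) / d] for [d > 0]. *)
Definition qpos (a : nat) := nfst a.
Definition qneg (a : nat) := nfst (nsnd a).
Definition qden (a : nat) := (nsnd (nsnd a)).+1.

Definition qmk (i j d : nat) : nat := npair i (npair j d.-1).

Definition qnat (n : nat) : nat := qmk n 0 1.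

Definition qopp (a : nat) : nat := qmk (qneg a) (qpos a) (qden a).

Definition qadd (a b : nat) : nat :=
  qmk (qpos a * qden b + qpos b * qden a) (qneg a * qden b + qneg b * qden a)
      (qden a * qden b).

Definition qsub (a b : nat) : nat := qadd a (qopp b).

Definition qmul (a b : nat) : nat :=
  qmk (qpos a * qpos b + qneg a * qneg b) (qpos a * qneg b + qneg a * qpos b)
      (qden a * qden b).

Definition qabs (a : nat) : nat :=
  qmk ((qpos a - qneg a) + (qneg a - qpos a)) 0 (qden a).

(** Truncated subtraction decides the sign of a notation: the result denotes 0
    for a nonpositive number and a number that is at least 1 otherwise. *)
Definition qpenalty (a : nat) : nat := qnat (qpos a - qneg a).

Section QComputable.
Variables f g h : (nat -> nat) -> nat -> nat.
Hypotheses (cf : computable f) (cg : computable g) (ch : computable h).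

Lemma computable_qpos : computable (fun p x => qpos (f p x)).
Proof. exact: computable_fst. Qed.

Lemma computable_qneg : computable (fun p x => qneg (f p x)).
Proof. by apply/computable_fst/computable_snd. Qed.

Lemma computable_qden : computable (fun p x => qden (f p x)).
Proof. by apply/computable_succ/computable_snd/computable_snd. Qed.

Lemma computable_qmk : computable (fun p x => qmk (f p x) (g p x) (h p x)).
Proof.
apply: computable_pair => //; apply: computable_pair => //.
exact: computable_pred.
Qed.

End QComputable.

Section QComputableOperations.
Variables f g : (nat -> nat) -> nat -> nat.
Hypotheses (cf : computable f) (cg : computable g).

Lemma computable_qopp : computable (fun p x => qopp (f p x)).
Proof.
by apply: computable_qmk;
  [exact: computable_qneg | exact: computable_qpos | exact: computable_qden].
Qed.

Lemma computable_qadd : computable (fun p x => qadd (f p x) (g p x)).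
Proof.
apply: computable_qmk; do ?[apply: computable_add]; apply: computable_mul;
  by [exact: computable_qpos | exact: computable_qneg | exact: computable_qden].
Qed.

Lemma computable_qmul : computable (fun p x => qmul (f p x) (g p x)).
Proof.
apply: computable_qmk; do ?[apply: computable_add]; apply: computable_mul;
  by [exact: computable_qpos | exact: computable_qneg | exact: computable_qden].
Qed.

Lemma computable_qabs : computable (fun p x => qabs (f p x)).
Proof.
apply: computable_qmk;
  [apply: computable_add; apply: computable_sub | exact: computable_const | ];
  by [exact: computable_qpos | exact: computable_qneg | exact: computable_qden].
Qed.

Lemma computable_qpenalty : computable (fun p x => qpenalty (f p x)).
Proof.
apply: computable_qmk; do ?exact: computable_const.
by apply: computable_sub; [exact: computable_qpos | exact: computable_qneg].
Qed.

End QComputableOperations.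

Lemma computable_qsub f g : computable f -> computable g ->
  computable (fun p x => qsub (f p x) (g p x)).
Proof.
by move=> cf cg; apply: computable_qadd => //; exact: computable_qopp.
Qed.

Section QValues.
Variable R : realType.
Implicit Types a b : nat.

Lemma nuQE a : nuQ R a = ((qpos a)%:R - (qneg a)%:R) / (qden a)%:R.
Proof. by []. Qed.

Lemma nuQ_qmk i j d : (0 < d)%N -> nuQ R (qmk i j d) = (i%:R - j%:R) / d%:R.
Proof. by case: d => // d _; rewrite /nuQ /qmk !npairK. Qed.

Lemma qden_neq0 a : (qden a)%:R != 0 :> R.
Proof. by rewrite pnatr_eq0. Qed.

Lemma nuQ_qnat n : nuQ R (qnat n) = n%:R.
Proof. by rewrite nuQ_qmk// subr0 divr1. Qed.

Lemma nuQ_qopp a : nuQ R (qopp a) = - nuQ R a.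
Proof. by rewrite nuQ_qmk// nuQE -mulNr opprB. Qed.

Lemma nuQ_qadd a b : nuQ R (qadd a b) = nuQ R a + nuQ R b.
Proof.
rewrite nuQ_qmk ?muln_gt0// !nuQE !natrD !natrM.
by field; rewrite !qden_neq0.
Qed.

Lemma nuQ_qsub a b : nuQ R (qsub a b) = nuQ R a - nuQ R b.
Proof. by rewrite nuQ_qadd nuQ_qopp. Qed.

Lemma nuQ_qmul a b : nuQ R (qmul a b) = nuQ R a * nuQ R b.
Proof.
rewrite nuQ_qmk ?muln_gt0// !nuQE !natrD !natrM.
by field; rewrite !qden_neq0.
Qed.

Lemma nuQ_qabs a : nuQ R (qabs a) = `|nuQ R a|.
Proof.
rewrite nuQ_qmk// nuQE normrM normfV normr_nat subr0 natrD; congr (_ / _).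
have [le|/ltnW le] := leqP (qpos a) (qneg a).
  by rewrite (eqP (le : _ - _ == 0)%N) add0r natrB// distrC ger0_norm//
     subr_ge0 ler_nat.
by rewrite (eqP (le : _ - _ == 0)%N) addr0 natrB// ger0_norm// subr_ge0 ler_nat.
Qed.

Lemma nuQ_qpenalty_ge0 a : 0 <= nuQ R (qpenalty a).
Proof. by rewrite nuQ_qnat. Qed.

Lemma nuQ_qpenalty0 a : nuQ R a <= 0 -> nuQ R (qpenalty a) = 0.
Proof.
rewrite nuQE ler_pdivrMr ?ltr0n// mul0r subr_le0 ler_nat => le.
by rewrite nuQ_qnat (eqP (le : _ - _ == 0)%N).
Qed.

Lemma nuQ_qpenalty_lt1 a : nuQ R (qpenalty a) < 1 -> nuQ R a <= 0.
Proof.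
rewrite nuQ_qnat ltrn1 ltnS leqn0 subn_eq0 => le.
by rewrite nuQE ler_pdivrMr ?ltr0n// mul0r subr_le0 ler_nat.
Qed.

Lemma nuQ_dense (x y : R) : x < y -> exists a, x < nuQ R a < y.
Proof.
move=> /rat_in_itvoo[q]; rewrite in_itv /= => qxy.
pose n := numq q; pose d := `|denq q|%N.
have d_gt0 : (0 < d)%N by rewrite absz_gt0 denq_neq0.
suff: exists i j, n = i%:Z - j%:Z.
  move=> [i [j nE]]; exists (qmk i j d); rewrite nuQ_qmk//.
  suff -> : (i%:R - j%:R) / d%:R = ratr q :> R by [].
  rewrite /ratr -/n nE rmorphB /= -!pmulrn; congr (_ / _).
  by rewrite -[in RHS](gtz0_abs (denq_gt0 q)).
case: n => [i|i]; first by exists i, 0%N; rewrite subr0.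
by exists 0%N, i.+1; rewrite NegzE sub0r.
Qed.

Lemma nuQ_approx (x e : R) : 0 < e -> exists a, `|x - nuQ R a| < e.
Proof.
move=> e0; have [|a] := @nuQ_dense (x - e) (x + e); first by lra.
by move=> /andP[xa ax]; exists a; rewrite ltr_norml; lra.
Qed.

End QValues.

(** * The excess of a radius *)

Section Modulus.
Variable R : realType.
Implicit Types z : R[i].

Lemma normcE z : normc z = Num.sqrt (Re z ^+ 2 + Im z ^+ 2).
Proof. by case: z. Qed.

Lemma normc_ge0 z : 0 <= normc z.
Proof. by rewrite normcE sqrtr_ge0. Qed.

Lemma ler_Re_normc z : `|Re z| <= normc z.
Proof. by rewrite normcE -sqrtr_sqr ler_wsqrtr// lerDl sqr_ge0. Qed.

Lemma ler_normcl z (e : R) : Re z ^+ 2 + Im z ^+ 2 <= e ^+ 2 -> normc z <= `|e|.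
Proof. by rewrite normcE -sqrtr_sqr => le; rewrite ler_wsqrtr. Qed.

Lemma sqr_normcE z : normc z ^+ 2 = Re z ^+ 2 + Im z ^+ 2.
Proof. by rewrite normcE sqr_sqrtr// addr_ge0// sqr_ge0. Qed.

Lemma normcR (x : R) : normc x%:C = `|x|.
Proof. by rewrite normcE /= expr0n addr0 sqrtr_sqr. Qed.

Lemma ler_normc_ReIm z : normc z <= `|Re z| + `|Im z|.
Proof.
rewrite -[leRHS]ger0_norm ?addr_ge0//; apply: ler_normcl.
rewrite sqrrD !real_normK ?num_real// -addrA [_ *+ 2 + _]addrC addrA lerDl.
by rewrite mulrn_wge0// mulr_ge0.
Qed.

Lemma ler_Im_normc z : `|Im z| <= normc z.
Proof. by rewrite normcE -sqrtr_sqr ler_wsqrtr// lerDr sqr_ge0. Qed.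

Lemma ler_dist_distB (x y q : R) : `| `|x - q| - `|y - q| | <= `|x - y|.
Proof. by apply: (le_trans (ler_dist_dist _ _)); rewrite opprB addrA subrK. Qed.

End Modulus.

(** An index [k = ix j n q1 q2 w e] consists of the number [j] of an entry, the
    number [n] of an approximation, and rational guesses of the real and
    imaginary part of the entry, of the real point and of the radius. *)
Definition ix_row (k : nat) := nfst k.
Definition ix_stage (k : nat) := nfst (nsnd k).
Definition ix_re (k : nat) := nfst (nsnd (nsnd k)).
Definition ix_im (k : nat) := nfst (nsnd (nsnd (nsnd k))).
Definition ix_pt (k : nat) := nfst (nsnd (nsnd (nsnd (nsnd k)))).
Definition ix_rad (k : nat) := nsnd (nsnd (nsnd (nsnd (nsnd k)))).

Definition ix (j n q1 q2 w e : nat) : nat :=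
  npair j (npair n (npair q1 (npair q2 (npair w e)))).

(** The part of the excess that depends on rational numbers alone, with the
    penalty for [|q1 - w + i q2| > |e|] expressed by squares. *)
Definition qoffset (k : nat) : nat :=
  let u := qsub (ix_re k) (ix_pt k) in
  let y := ix_im k in
  let e := ix_rad k in
  qadd (qmk 1 0 (ix_stage k).+1)
       (qpenalty (qsub (qadd (qmul u u) (qmul y y)) (qmul e e))).

Section Excess.
Variable R : realType.
Variable s : R.
Local Notation nu := (nuQ R).

(** How far [k] is from witnessing, by accurate guesses, that [a] is at distance
    at most [s] from the real point approximated by [b]. *)
Definition excess (k : nat) (a b : CC R) : R :=
  `|Re a - nu (ix_re k)| + `|Im a - nu (ix_im k)| + `|Re b - nu (ix_pt k)| +
  `|s - nu (ix_rad k)| + nu (qoffset k).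

Lemma nuQ_qoffset k : nu (qoffset k) = (ix_stage k).+1%:R^-1 +
  nu (qpenalty (qsub
    (qadd (qmul (qsub (ix_re k) (ix_pt k)) (qsub (ix_re k) (ix_pt k)))
          (qmul (ix_im k) (ix_im k)))
    (qmul (ix_rad k) (ix_rad k)))).
Proof. by rewrite /qoffset nuQ_qadd [nu (qmk _ _ _)]nuQ_qmk// subr0 mul1r. Qed.

Lemma excess_ge0 k a b : 0 <= excess k a b.
Proof.
by rewrite /excess nuQ_qoffset !addr_ge0 ?nuQ_qpenalty_ge0// invr_ge0.
Qed.

Lemma exprn_le_invS n : 2 ^- n.+2 <= n.+1%:R^-1 :> R.
Proof.
rewrite lef_pV2 ?posrE ?exprn_gt0// -natrX ler_nat.
by rewrite (leq_trans (ltnW (ltn_expl n.+1 (ltnSn 1))))// leq_exp2l.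
Qed.

Lemma exists_invS_lt (e : R) : 0 < e -> exists n, n.+1%:R^-1 < e.
Proof.
move=> e0; exists (Num.bound e^-1).
rewrite invf_plt ?posrE//.
apply: (lt_le_trans (archi_boundP _)); first by rewrite invr_ge0 ltW.
by rewrite ler_nat.
Qed.

(** The vector from [z] to [a] and its guess, the vector from [w] to
    [q1 + i q2], differ by the errors of the guesses and the error of the
    approximation [b] of [z]. *)
Lemma normc_differences (a b : CC R) (z q1 q2 w : R) :
  normc ((a - z%:C : R[i]) - ((q1 - w) +i* q2)) <=
  `|Re a - q1| + `|Im a - q2| + `|Re b - w| + normc (b - z%:C : R[i]).
Proof.
have := ler_Re_normc (b - z%:C : R[i]).
move=> reb; apply: (le_trans (ler_normc_ReIm _)); move: reb.
case: a b => [ar ai] [br bi] /= reb.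
have -> : ar - z - (q1 - w) = (ar - q1) - (br - w) + (br - z) by ring.
have := ler_normD ((ar - q1) - (br - w)) (br - z).
have := ler_normB (ar - q1) (br - w).
rewrite subr0; lra.
Qed.

(** A small excess makes all guesses accurate and excludes the penalty, so the
    rational inequality [|q - w| <= |e|] yields [|a j - z| <= s] up to a
    multiple of the excess. Conversely, if [|a j - z|] is almost at most [s],
    accurate guesses [q] and [w] exist, and a guess [e] slightly above [s]
    absorbs their errors in the rational inequality. *)
Lemma excess_small (a b : nat -> CC R) (z : R) : 0 <= s ->
  (forall n, normc (b n - z%:C : R[i]) <= 2 ^- n.+2) ->
  (forall e : R, 0 < e ->
     exists k, excess k (a (ix_row k)) (b (ix_stage k)) < e) <->
  (forall e : R, 0 < e -> exists j, normc (a j - z%:C : R[i]) < s + e).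
Proof.
move=> s0 bz; split=> H e e0.
- have [|k] := H (Num.min 1 (e / 2)); first by rewrite lt_min; lra.
  rewrite lt_min => /andP[].
  rewrite /excess nuQ_qoffset.
  have bn := le_trans (bz (ix_stage k)) (exprn_le_invS (ix_stage k)).
  have := normc_differences (a (ix_row k)) (b (ix_stage k)) z
    (nu (ix_re k)) (nu (ix_im k)) (nu (ix_pt k)).
  set N := _^-1 in bn *; set Q := (_ +i* _).
  set A := `| _ |; set B := `| _ |; set D := `| _ |; set E := `| _ |.
  have [A0 B0] : 0 <= A /\ 0 <= B by rewrite !normr_ge0.
  have [D0 E0] : 0 <= D /\ 0 <= E by rewrite !normr_ge0.
  have N0 : 0 <= N by rewrite invr_ge0.
  set v := qsub _ (qmul _ _).
  have P0 := nuQ_qpenalty_ge0 R v.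
  move=> diff lt1 lt2; exists (ix_row k).
  have /nuQ_qpenalty_lt1 : nu (qpenalty v) < 1 by lra.
  rewrite /v nuQ_qsub nuQ_qadd !nuQ_qmul nuQ_qsub -!expr2 subr_le0.
  move=> /(@ler_normcl _ Q) normQ.
  have nurad : `|nu (ix_rad k)| <= s + E.
    rewrite -[s]ger0_norm// (le_trans _ (ler_normB _ _))//.
    by rewrite opprB addrC subrK.
  have := le_normcD ((a (ix_row k) - z%:C : R[i]) - Q) Q.
  by rewrite subrK; lra.
- (* The five summands are below d, d, d, 8 d and d; the guess of the radius
     must exceed s by the error 5 d of the guessed distance. *)
  pose d : R := e / 16.
  have d0 : 0 < d by rewrite /d; lra.
  have [n nd] := exists_invS_lt d0.
  have bn := le_lt_trans (le_trans (bz n) (exprn_le_invS n)) nd.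
  have [j jd] := H d d0.
  have [q1 q1d] := nuQ_approx (Re (a j)) d0.
  have [q2 q2d] := nuQ_approx (Im (a j)) d0.
  have [w wd] := nuQ_approx (Re (b n)) d0.
  have [|q /andP[qs qd]] := @nuQ_dense R (s + 6 * d) (s + 7 * d); first by lra.
  have := normc_differences (a j) (b n) z (nu q1) (nu q2) (nu w).
  set Q := (_ +i* _) => diff.
  exists (ix j n q1 q2 w q).
  rewrite /excess nuQ_qoffset /ix_row /ix_stage /ix_re /ix_im /ix_pt /ix_rad.
  rewrite /ix !npairK nuQ_qpenalty0; last first.
    rewrite nuQ_qsub nuQ_qadd !nuQ_qmul nuQ_qsub -!expr2 subr_le0.
    rewrite -(sqr_normcE Q) ler_pXn2r ?nnegrE ?normc_ge0//; last by lra.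
    have -> : Q = (a j - z%:C : R[i]) - ((a j - z%:C : R[i]) - Q)
      by rewrite opprB addrC subrK.
    apply: (le_trans (le_normcD _ _)); rewrite normcN; lra.
  have : `|s - nu q| < 8 * d by rewrite ltr_norml; lra.
  have -> : e = 16 * d by rewrite /d; field.
  by rewrite addr0; move: nd; set N := _^-1; lra.
Qed.

End Excess.

(** * Spectra of diagonal operators *)

Section ComplexTopology.
Variable R : realType.

Lemma ball_CC (z y : CC R) (e : R) : ball z e%:C y <-> normc (y - z : R[i]) < e.
Proof.
rewrite -ball_normE /= distrC.
by rewrite -[`|y - z|]/((normc (y - z : R[i]))%:C) ltcR.
Qed.

Lemma nbhs_CC (z : CC R) (P : set (CC R)) :
  nbhs z P <-> exists2 e : R, 0 < e & forall y, normc (y - z : R[i]) < e -> P y.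
Proof.
split=> [/nbhs_ballP[[e e'] /=]|[e e0 eP]]; last apply/nbhs_ballP.
  rewrite ltcE /= => /andP[/eqP -> e0] eP; exists e => // y ye.
  by apply: eP; apply/ball_CC.
exists e%:C; first by rewrite /= ltcR.
by move=> y /ball_CC; exact: eP.
Qed.

Lemma closure_CC (A : set (CC R)) z :
  closure A z <->
  forall e : R, 0 < e -> exists2 y, A y & normc (y - z : R[i]) < e.
Proof.
split=> [Az e e0|H B /nbhs_CC[e e0 eB]].
  have [|y [Ay ye]] := Az [set y | normc (y - z : R[i]) < e]; last by exists y.
  by apply/nbhs_CC; exists e.
by have [y Ay ye] := H e e0; exists y; split=> //; exact: eB.
Qed.

End ComplexTopology.

Section Ell2.
Variable R : realType.
Implicit Types x y : vec R.

(** Diagonal operators act coordinatewise, so pointwise bounds on the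
    coordinates are enough to control membership and norm of their values. *)
Lemma ell2_dominated (M : R) x y : 0 <= M ->
  (forall j, normc (x j) <= M * normc (y j)) -> ell2 y ->
  ell2 x /\ norm2 x <= M * norm2 y.
Proof.
move=> M0 xy ly.
pose u j : R := normc (x j) ^+ 2; pose v j : R := normc (y j) ^+ 2.
have cMv : cvgn (series (M ^+ 2 *: v)) by exact: is_cvg_seriesZ.
have uMv j : u j <= (M ^+ 2 *: v) j.
  rewrite /u -[leRHS]/(M ^+ 2 * normc (y j) ^+ 2) -exprMn ler_pXn2r// nnegrE
    ?normc_ge0//.
  by rewrite mulr_ge0// normc_ge0.
have lx : cvgn (series u).
  apply: series_le_cvg cMv => // j; first by rewrite sqr_ge0.
  by rewrite (le_trans (sqr_ge0 _) (uMv j)).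
split=> //; rewrite /norm2 -[M]ger0_norm// -sqrtr_sqr -sqrtrM ?sqr_ge0//.
apply: ler_wsqrtr.
rewrite -[_ * _](lim_seriesZ (M ^+ 2) (ly : cvgn (series v))).
exact: lim_series_le.
Qed.

Lemma norm2_basis (c : CC R) j :
  ell2 (fun i => c * basis R j i) /\ norm2 (fun i => c * basis R j i) = normc c.
Proof.
have E : \forall n \near \oo,
    series (fun i => normc (c * basis R j i) ^+ 2) n = normc c ^+ 2.
  exists j.+1 => // n /= jn.
  rewrite /series /= (@bigD1_seq _ _ _ _ _ j) ?iota_uniq ?mem_index_iota//=.
  rewrite /basis eqxx mulr1 big1 ?addr0// => i /negPf ->.
  by rewrite mulr0 normc0 expr0n.
split; first exact: is_cvg_near_cst E.
by rewrite /norm2 (lim_near_cst _ E)// sqrtr_sqr ger0_norm// normc_ge0.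
Qed.

End Ell2.

Section Diagonal.
Variable R : realType.
Implicit Types (a : nat -> CC R) (x y : vec R) (z : CC R) (j : nat).

(** For a diagonal operator this describes the spectrum if [s = 0] and the
    pseudospectrum for the parameter [s] if [s > 0]; the infimum of the
    distances need not be attained, hence the margin [e]. *)
Definition approached (s : R) a z :=
  forall e : R, 0 < e -> exists j, normc (a j - z : R[i]) < s + e.

Lemma ell2Z (c : CC R) x : ell2 x -> ell2 (fun j => c * x j).
Proof.
move=> lx; have [] := @ell2_dominated R (normc c) (fun j => c * x j) x => //.
  exact: normc_ge0.
by move=> j; rewrite normcM.
Qed.

Lemma ell2B x y : ell2 x -> ell2 y -> ell2 (fun j => x j - y j).
Proof.
move=> lx ly.
pose u j : R := normc (x j) ^+ 2; pose v j : R := normc (y j) ^+ 2.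
have cuv : cvgn (series (2 *: (u + v))).
  by apply: is_cvg_seriesZ; exact: is_cvg_seriesD.
have uv j : normc (x j - y j : R[i]) ^+ 2 <= (2 *: (u + v)) j.
  rewrite -[leRHS]/(2 * (u j + v j)) /u /v.
  have := le_normcD (x j : R[i]) (- y j : R[i]); rewrite normcN.
  have := normc_ge0 (x j - y j : R[i]).
  move: (normc (x j)) (normc (y j)) (normc _) => p q t t0 tpq.
  have : t ^+ 2 <= (p + q) ^+ 2 by rewrite ler_pXn2r// nnegrE; lra.
  have := sqr_ge0 (p - q); lra.
apply: series_le_cvg cuv => // j; first by rewrite sqr_ge0.
exact: le_trans (sqr_ge0 _) (uv j).
Qed.

Lemma shift_diagP a z x y : shift (diag a) z (x, y) <->
  [/\ ell2 x, ell2 (fun j => a j * x j) & y = (fun j => (a j - z) * x j)].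
Proof.
split=> [[w [/= lx lax ->] ->]|[lx lax ->]].
  by split=> //; apply/funext => j; rewrite mulrBl.
by exists (fun j => a j * x j) => //=; apply/funext => j; rewrite mulrBl.
Qed.

Lemma shift_diag_basis a z c j : shift (diag a) z
  (fun i => c * basis R j i, fun i => ((a j - z) * c) * basis R j i).
Proof.
apply/shift_diagP; split; first exact: (norm2_basis c j).1.
  suff -> : (fun i => a i * (c * basis R j i)) =
            (fun i => (a j * c) * basis R j i).
    exact: (norm2_basis (a j * c) j).1.
  apply/funext => i; rewrite /basis.
  by case: eqVneq => [->|]; rewrite ?mulr0// !mulr1.
apply/funext => i; rewrite /basis.
by case: eqVneq => [->|]; rewrite ?mulr0// !mulr1.
Qed.

Section Gap.
Variables (a : nat -> CC R) (z : CC R) (d : R).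
Hypothesis d_gt0 : 0 < d.
Hypothesis gap : forall j, d <= normc (a j - z : R[i]).

Lemma norm2_inverse_shift x y :
  shift (diag a) z (x, y) -> norm2 x <= d^-1 * norm2 y.
Proof.
move=> /shift_diagP[lx lax yE].
have ly : ell2 y.
  rewrite yE.
  suff -> : (fun j => (a j - z) * x j) = (fun j => a j * x j - z * x j).
    by apply: ell2B => //; exact: ell2Z.
  by apply/funext => j; rewrite mulrBl.
have [] // := @ell2_dominated R d^-1 x y; first by rewrite invr_ge0 ltW.
move=> j; rewrite yE normcM mulrA ler_peMl ?normc_ge0//.
by rewrite mulrC ler_pdivlMr// mul1r.
Qed.

Lemma gap_resolvent : resolvent_set (diag a) z.
Proof.
have nz j : a j - z != 0.
  apply/eqP => az; have := gap j; by rewrite az normc0 leNgt d_gt0.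
split=> [y ly|]; last first.
  by exists d^-1 => -[y x]; exact: norm2_inverse_shift.
pose x : vec R := fun j => (a j - z)^-1 * y j.
have lx : ell2 x.
  have [] // := @ell2_dominated R d^-1 x y; first by rewrite invr_ge0 ltW.
  move=> j; rewrite /x normcM normcV ler_wpM2r ?normc_ge0//.
  by rewrite lef_pV2 ?posrE// (lt_le_trans d_gt0).
exists x; split=> [|x' /shift_diagP[_ _ yE]].
  apply/shift_diagP; split=> //.
    suff -> : (fun j => a j * x j) = (fun j => y j - (- z) * x j).
      by apply: ell2B => //; exact: ell2Z.
    apply/funext => j; rewrite mulNr opprK.
    rewrite -[in RHS](@mulVKf _ (a j - z) (nz j) (y j)) -/(x j).
    by rewrite -mulrDl subrK.
  by apply/funext => j; rewrite /x mulVKf.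
by apply/funext => j; rewrite /x yE mulKf.
Qed.

End Gap.

(** A gap makes the coordinatewise inverse bounded; without a gap the images of
    the basis vectors have arbitrarily small norm, so no bound exists. *)
Lemma spectrum_diagP a z : spectrum (diag a) z <-> approached 0 a z.
Proof.
split=> [zP e e0|az [_ [M Mb]]].
  apply: contrapT => /forallNP H; apply: zP.
  apply: (@gap_resolvent a z e) => // j.
  by rewrite leNgt; apply/negP => lt; apply: (H j); rewrite add0r.
have [|j] := az (`|M| + 1)^-1; first by rewrite invr_gt0 ltr_wpDl.
rewrite add0r => lt.
have := Mb (fun i => ((a j - z) * 1) * basis R j i, fun i => 1 * basis R j i)
  (shift_diag_basis a z 1 j).
rewrite /= (norm2_basis _ j).2 (norm2_basis _ j).2 mulr1 normc1.
apply/negP; rewrite -ltNge.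
apply: (@le_lt_trans _ _ (`|M| * normc (a j - z : R[i]))).
  by rewrite ler_wpM2r ?normc_ge0// ler_norm.
have M1 : 0 < `|M| + 1 by rewrite ltr_wpDl.
apply: (@le_lt_trans _ _ (`|M| * (`|M| + 1)^-1)).
  by rewrite ler_wpM2l// ltW.
by rewrite ltr_pdivrMr// mul1r ltrDl.
Qed.

(** The norm of the resolvent is the supremum of the inverse distances to the
    entries: multiples of basis vectors attain each of them. *)
Lemma resolvent_norm_gt (eps : R) a z : 0 < eps ->
  ((eps^-1)%:E < resolvent_norm (diag a) z)%E <->
  exists j, normc (a j - z : R[i]) < eps.
Proof.
move=> eps0; split=> [|[j lt]].
  apply: contraPP => /forallNP H.
  have gap j : eps <= normc (a j - z : R[i]) by rewrite leNgt; apply/negP/H.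
  apply/negP; rewrite -leNgt /resolvent_norm asboolF; last first.
    by move=> zs; apply: zs; exact: (gap_resolvent eps0 gap).
  apply: ge_ereal_sup => _ [[y x] [/= yx y1] <-]; rewrite lee_fin.
  apply: (le_trans (norm2_inverse_shift eps0 gap yx)).
  by rewrite ler_piMr// invr_ge0 ltW.
rewrite /resolvent_norm; case: asboolP => [|zr]; first by rewrite ltry.
have nz : a j - z != 0.
  apply/eqP => az; apply: zr; apply/spectrum_diagP => e e0; exists j.
  by rewrite az normc0 add0r.
pose c := (a j - z)^-1.
apply: (@lt_le_trans _ _ (norm2 (fun i => c * basis R j i))%:E).
  rewrite lte_fin (norm2_basis _ j).2 normcV ltf_pV2// posrE.
  rewrite lt_neqAle normc_ge0 andbT eq_sym.
  by apply: contra nz => /eqP/eq0_normc ->.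
apply: ereal_sup_ubound.
exists (fun i => ((a j - z) * c) * basis R j i, fun i => c * basis R j i) => //.
split; first exact: shift_diag_basis.
by rewrite /= (norm2_basis _ j).2 divff// normc1.
Qed.

(** The set that is closed is the union of the open discs of radius [eps] about
    the entries; a point at distance less than [eps + e] from an entry enters
    its disc after a move towards it by less than [e]. *)
Lemma pseudospectrum_diagP (eps : R) a z : 0 < eps ->
  pseudospectrum eps (diag a) z <-> approached eps a z.
Proof.
move=> eps0; split=> [/closure_CC H e e0|H].
  have [y /= /(resolvent_norm_gt _ _ eps0)[j lt] yz] := H e e0.
  exists j; apply: le_lt_trans (ltrD lt yz).
  by rewrite (le_trans _ (le_normcD _ _))// addrA subrK.
apply/closure_CC => e e0; have [j lt] := H e e0.
have epse : 0 < eps + e by lra.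
pose t : R := e / (eps + e).
have t01 : 0 < t < 1.
  by rewrite divr_gt0//= ltr_pdivrMr// mul1r ltrDr.
(* The fraction t of the way scales eps + e to e, leaving eps. *)
exists (z + t%:C * (a j - z)).
  apply/(resolvent_norm_gt _ _ eps0); exists j.
  have -> : a j - (z + t%:C * (a j - z)) = (1 - t)%:C * (a j - z).
    by rewrite rmorphB rmorph1 /=; ring.
  rewrite normcM normcR ger0_norm; last by lra.
  have -> : eps = (1 - t) * (eps + e) by rewrite /t; field; lra.
  by rewrite ltr_pM2l//; lra.
rewrite addrAC subrr add0r normcM normcR ger0_norm; last by lra.
have -> : e = t * (eps + e) by rewrite /t; field; lra.
by rewrite ltr_pM2l//; lra.
Qed.

End Diagonal.

(** * Continuity of maps between instances *)

Section ProductTopology.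
Variables (I : Type) (T : I -> topologicalType).

Lemma continuous_to_prod (X : topologicalType) (f : X -> prod_topology T) :
  (forall i, continuous (fun x => f x i)) -> continuous f.
Proof.
move=> cf x; apply/cvg_sup => i.
exact: (@continuous_comp_initial _ X (T i)
  (fun g : prod_topology T => g i) f (cf i) x).
Qed.

Lemma continuous_eval i : continuous (fun g : prod_topology T => g i).
Proof.
move=> g.
have /cvg_sup/(_ i) gi : nbhs g --> (g : prod_topology T) by exact: cvg_id.
move=> A gA; apply: gi.
exact: (@initial_continuous _ _ (fun g : prod_topology T => g i) g A gA).
Qed.

End ProductTopology.

(** The evaluations of the image are the continuous maps [ttheta] applied to
    evaluations of the argument, and the topologies of instances are initial. *)
Lemma continuous_tE (R : realType) (S P : problem R) (t : transport S P) :
  (forall f, continuous (ttheta t f)) ->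
  continuous (tE t : inst_top S -> inst_top P).
Proof.
move=> ct; apply: continuous_comp_initial; apply: continuous_to_prod => f.
have -> : (fun x => (@table R P \o tE t) x f) =
    ttheta t f \o (fun x : inst_top S => fun k => table x (tquery t f k)).
  by apply/funext => x; exact: t_ev.
move=> x; apply: continuous_comp; last exact: ct.
apply: continuous_to_prod => k {}x.
apply: (@continuous_comp _ _ _ (@table R S : inst_top S -> _)
  (fun g => g (tquery t f k))); first exact: initial_continuous.
exact: continuous_eval.
Qed.

(** * The new evaluations and their program *)

Lemma mu_diag (R : realType) (a : nat -> CC R) j : mu j (diag a) = a j.
Proof.
apply: xget_unique => [|c [_ _ /(congr1 (fun x => x j))]] /=; last first.
  by rewrite /basis eqxx !mulr1.
have E : (fun i => a j * basis R j i) = (fun i => a i * basis R j i).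
  by apply/funext => i; rewrite /basis; case: eqVneq => [->//|]; rewrite !mulr0.
have [l1 _] := norm2_basis (1 : CC R) j; have [l2 _] := norm2_basis (a j) j.
split=> //=; last by rewrite -E.
by move: l1; congr ell2; apply/funext => i; rewrite mul1r.
Qed.

Definition excess_code (k A1 A2 B S : nat) : nat :=
  qadd (qadd (qadd (qadd (qabs (qsub A1 (ix_re k))) (qabs (qsub A2 (ix_im k))))
    (qabs (qsub B (ix_pt k)))) (qabs (qsub S (ix_rad k)))) (qoffset k).

Lemma excess_code_approx (R : realType) (s d : R) k A1 A2 B S (a b : CC R) :
  `|nuQ R A1 - Re a| <= d -> `|nuQ R A2 - Im a| <= d ->
  `|nuQ R B - Re b| <= d -> `|nuQ R S - s| <= d ->
  `|nuQ R (excess_code k A1 A2 B S) - excess s k a b| <= 4 * d.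
Proof.
rewrite /excess /excess_code !nuQ_qadd !nuQ_qabs !nuQ_qsub.
have dist (x y q : R) : `|x - y| <= d -> `| `|x - q| - `|y - q| | <= d.
  exact: le_trans (ler_dist_distB _ _ _).
move=> /(dist _ _ (nuQ R (ix_re k))) + /(dist _ _ (nuQ R (ix_im k))).
move=> + + /(dist _ _ (nuQ R (ix_pt k))) + /(dist _ _ (nuQ R (ix_rad k))).
by rewrite !ler_norml; lra.
Qed.

(** The approximation of order [m] of the evaluation with code [c], even for
    entries and odd for approximants of the point, from the values [U] and [V]
    at [m + 3] of names of the two queried numbers. Six quantities, each with
    error at most [2 ^- (m + 3)], enter the result. *)
Definition entry_code (q0 qx qt qs : nat -> nat) (c m U V : nat) : nat :=
  if odd c then q0 (npair c./2 m) else
  npair (qadd (qadd (qx m.+3) (qt m.+3))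
          (excess_code c./2 (nfst U) (nsnd U) (nfst V) (qs m.+3)))
        (qnat 0).

Definition total_code (q : nat -> nat) := exists c, forall n, eval0 c n (q n).

Section Entry.
Variables (R : realType) (x0 s tau : R) (z0 : nat -> CC R).
Variables (q0 qx qt qs : nat -> nat).
Hypotheses (cq0 : total_code q0) (cqx : total_code qx) (cqt : total_code qt)
  (cqs : total_code qs).
Hypotheses (q0P : forall n, complex_rep (section q0 n) (z0 n))
  (qxP : real_rep qx x0) (qtP : real_rep qt tau) (qsP : real_rep qs s).

Definition entry (f : nat + nat) (a b : CC R) : CC R :=
  match f with
  | inl k => (x0 + tau + excess s k a b)%:C
  | inr n => z0 n
  end.

Local Notation ecode := (entry_code q0 qx qt qs).

Lemma entry_codeP f u v a b : complex_rep u a -> complex_rep v b ->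
  complex_rep (fun m => ecode (code_diag f) m (u m.+3) (v m.+3)) (entry f a b).
Proof.
move=> ua vb m; rewrite /entry_code.
case: f => [k|n] /=; rewrite ?odd_double /=; last first.
  by rewrite uphalf_double; exact: q0P.
rewrite half_double !npairK nuQ_qnat.
have real_dist (y t : R) : normc (y +i* 0 - t%:C : R[i]) <= `|y - t|.
  by rewrite -normcR; rewrite rmorphB.
apply: (le_trans (real_dist _ _)).
rewrite nuQ_qadd [nuQ R (qadd (qx _) _)]nuQ_qadd.
set d : R := 2 ^- m.+3.
have dE : 2 ^- m = 8 * d.
  by rewrite /d !exprS; field; rewrite expf_neq0// pnatr_eq0.
have := qxP m.+3; have := qtP m.+3; rewrite -/d.
have := le_trans (ler_Re_normc _) (ua m.+3); rewrite -/d.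
have := le_trans (ler_Im_normc _) (ua m.+3); rewrite -/d.
have := le_trans (ler_Re_normc _) (vb m.+3); rewrite -/d.
have -> (z : CC R) (y t : R) : Re (y +i* t - z : R[i]) = y - Re z by case: z.
have -> (z : CC R) (y t : R) : Im (y +i* t - z : R[i]) = t - Im z by case: z.
have -> (z : CC R) (y t : R) : Re (y +i* t - z : R[i]) = y - Re z by case: z.
move=> h1 h2 h3.
have := excess_code_approx k h3 h2 h1 (qsP m.+3).
have d0 : 0 <= d by rewrite invr_ge0 exprn_ge0.
by rewrite dE !ler_norml; lra.
Qed.

Lemma computable_total q f : total_code q -> computable f ->
  computable (fun p x => q (f p x)).
Proof. by move=> [c]; exact: computable_eval0. Qed.

Lemma computable_entry_code c m U V :
  computable c -> computable m -> computable U -> computable V ->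
  computable (fun p x => ecode (c p x) (m p x) (U p x) (V p x)).
Proof.
move=> cc cm cU cV; have ck := computable_half cc.
have cm3 : computable (fun p x => (m p x).+3) by do 3!apply: computable_succ.
apply: computable_if; first exact: computable_odd.
  by apply: computable_total cq0 _; exact: computable_pair.
apply: computable_pair; last exact: computable_const.
have cix := computable_snd ck.
apply: computable_qadd.
  by apply: computable_qadd; exact: computable_total.
rewrite /excess_code /qoffset /ix_re /ix_im /ix_pt /ix_rad /ix_stage.
have cS := computable_total cqs cm3.
(* Each rule is selected by the head symbol: unification up to unfolding would
   confuse the operations, which are all built from pairing. *)
repeat lazymatch goal with
| |- computable (fun p x => qadd (@?f p x) (@?g p x)) => apply: computable_qadd
| |- computable (fun p x => qsub (@?f p x) (@?g p x)) => apply: computable_qsub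
| |- computable (fun p x => qmul (@?f p x) (@?g p x)) => apply: computable_qmul
| |- computable (fun p x => qabs (@?f p x)) => apply: computable_qabs
| |- computable (fun p x => qpenalty (@?f p x)) => apply: computable_qpenalty
| |- computable (fun p x => qmk 1 0 (@?f p x)) =>
    apply: (computable_qmk (computable_const 1) (computable_const 0));
    apply: computable_succ
| |- computable (fun p x => nfst (@?f p x)) => apply: computable_fst
| |- computable (fun p x => nsnd (@?f p x)) => apply: computable_snd
end; assumption.
Qed.

Lemma continuous_entry f :
  continuous (fun v : prod_topology (fun _ : 'I_2 => CC R) =>
    entry f (v ord0) (v ord_max)).
Proof.
move=> v A /nbhs_CC[e e0 eA].
have near i : \forall w \near v, normc (w i - v i : R[i]) < e / 4.
  have ni : nbhs (v i) [set y : CC R | normc (y - v i : R[i]) < e / 4].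
    by apply/nbhs_CC; exists (e / 4) => //; lra.
  exact: (@continuous_eval _ (fun=> CC R) i v _ ni).
suff H (w : 'I_2 -> CC R) : normc (w ord0 - v ord0 : R[i]) < e / 4 ->
    normc (w ord_max - v ord_max : R[i]) < e / 4 ->
    A (entry f (w ord0) (w ord_max)).
  exact: (@filterS2 _ (nbhs v) _ _ _ _ H (near ord0) (near ord_max)).
case: f eA => [k|n] eA; last by move=> _ _; apply: eA; rewrite subrr normc0.
move: (w ord0) (v ord0) (w ord_max) (v ord_max) eA => a a' b b' eA ha hb.
apply: eA; rewrite -rmorphB normcR /excess.
move: (ler_Re_normc (a - a' : R[i])) (ler_Im_normc (a - a' : R[i])).
move: (ler_Re_normc (b - b' : R[i])) ha hb.
have ReB (y y' : CC R) : Re (y - y' : R[i]) = Re y - Re y'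
  by case: y y' => ? ? [].
have ImB (y y' : CC R) : Im (y - y' : R[i]) = Im y - Im y'
  by case: y y' => ? ? [].
rewrite !ReB ImB => rb na nb ra ia.
have dist := @ler_dist_distB R.
move: (dist (Im a) (Im a') (nuQ R (ix_im k))).
move: (dist (Re a) (Re a') (nuQ R (ix_re k))).
move: (dist (Re b) (Re b') (nuQ R (ix_pt k))).
move=> d1 d2 d3.
move: (le_trans d1 rb) (le_trans d2 ra) (le_trans d3 ia); rewrite !ler_norml.
by rewrite ltr_norml; lra.
Qed.

End Entry.

(** * The transport *)

Section Transport.
Variables (R : realType) (J : set R) (r : set (CC R) -> nat -> rat * rat).
Variables (spec_s spec_t : operator R -> set (CC R)) (s tau x0 : R).
Hypotheses (r_approx : approximants J r) (Jx0 : J x0) (s_ge0 : 0 <= s)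
  (tau_ge0 : 0 <= tau).
Hypotheses
  (spec_sP : forall a z, spec_s (diag a) z <-> approached s a z)
  (spec_tP : forall a z, spec_t (diag a) z <-> approached tau a z).
Local Notation z0 := (fun n => gauss R (r [set (x0%:C : CC R)] n)).
Local Notation S := (diag_rep_problem spec_s J r).
Local Notation P := (diag_rep_problem spec_t J r).

Definition gadget (x : inst_diag J) (k : nat) : CC R :=
  entry x0 s tau z0 (inl k) (mu (ix_row k) (val x).1)
    (gauss R (r (val x).2 (ix_stage k))).

Lemma gadget_inst x :
  (diag (gadget x), [set (x0%:C : CC R)]) \in (@Omega_diag R `*` K_sgl J).
Proof. by apply/mem_set; split; [exists (gadget x) | exists x0]. Qed.

Definition gadget_map (x : inst_diag J) : inst_diag J :=
  exist (fun u => u \in (@Omega_diag R `*` K_sgl J)) _ (gadget_inst x).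

(** The distance of the new entries to [x0] is [tau] plus the excess, so
    [x0] is approached within [tau] iff the excess is arbitrarily small. *)
Lemma gadget_target x : target P (gadget_map x) = target S x.
Proof.
have disjoint (B : set (CC R)) z : B `&` [set z] = set0 <-> ~ B z.
  split=> [B0 Bz|nB]; first by have : (B `&` [set z]) z by []; rewrite B0.
  by apply/seteqP; split=> // y [By yz]; apply: nB; rewrite -yz.
apply: asbool_equiv_eq => /=.
case: x => -[A K] AK; have /set_mem[/= [a aE] [z Jz KE]] := AK.
rewrite /= KE aE in AK *; rewrite !disjoint spec_tP spec_sP.
apply: not_iff_compat.
apply: iff_trans (excess_small a s_ge0 (r_approx Jz)).
have entryE k :
    normc (gadget (exist _ (diag a, [set z%:C]) AK) k - x0%:C : R[i]) =
    tau + excess s k (a (ix_row k))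
            (gauss R (r [set (z%:C : CC R)] (ix_stage k))).
  rewrite /gadget /entry mu_diag -rmorphB normcR -[x0 + _ + _]addrA.
  by rewrite addrAC subrr add0r ger0_norm// addr_ge0// excess_ge0.
by split=> H e e0; have [k lt] := H e e0; exists k;
  move: lt; rewrite entryE ltrD2l.
Qed.

Definition argument (f : nat + nat) : nat :=
  match f with inl k | inr k => k end.

(** Both kinds of evaluations make two queries, so that the codes of the queries
    are one arithmetical expression in half the code of [f]. *)
Definition query (f : nat + nat) (i : 'I_2) : nat + nat :=
  if i == ord0 then inl (ix_row (argument f)) else inr (ix_stage (argument f)).

Definition theta (f : nat + nat)
    (v : prod_topology (fun _ : 'I_2 => CC R)) : CC R :=
  entry x0 s tau z0 f (v ord0) (v ord_max).

Lemma gadget_ev f x :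
  ev P f (gadget_map x) = theta f (fun i => ev S (query f i) x).
Proof. by case: f => [k|n] //=; rewrite mu_diag. Qed.

Definition gadget_transport : transport S P :=
  @Transport R S P gadget_map id (fun=> 2) query theta gadget_target gadget_ev.

Lemma gadget_le_cont : le_cont S P.
Proof.
have ctheta f : continuous (ttheta gadget_transport f).
  exact: (@continuous_entry R x0 s tau z0 f).
exists gadget_transport; split=> [||f].
- exact: continuous_tE.
- by move=> y A.
- by apply: continuous_subspaceT; exact: ctheta.
Qed.

Hypotheses (x0_comp : computable_pt (@real_rep R) x0)
  (s_comp : computable_pt (@real_rep R) s)
  (tau_comp : computable_pt (@real_rep R) tau)
  (r0_comp : computable_seq (@complex_rep R) z0).

Lemma half_code_diag f : (code_diag f)./2 = argument f.
Proof. by case: f => [k|n] /=; rewrite ?uphalf_double ?half_double. Qed.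

(** The name of an instance and the name of a tuple of queried values differ
    only in where [entry_code] finds the names of the two queried numbers. *)
Lemma gadget_le_TTE : le_TTE S P.
Proof.
have [cx [qx [cqx qxP]]] := x0_comp.
have [cs [qs [cqs qsP]]] := s_comp.
have [ct [qt [cqt qtP]]] := tau_comp.
have [c0 [q0 [cq0 q0P]]] := r0_comp.
have centry := computable_entry_code (ex_intro _ _ cq0) (ex_intro _ _ cqx)
  (ex_intro _ _ cqt) (ex_intro _ _ cqs).
have entryP := entry_codeP q0P qxP qtP qsP.
set ecode := entry_code q0 qx qt qs in centry entryP.
have cfst := computable_fst computable_id.
have csnd := computable_snd computable_id.
have cdouble g : computable g -> computable (fun p x => (g p x).*2).
  move=> cg; apply: (@eq_computable (fun p x => (g p x + g p x)%N)).
    by move=> p x; rewrite addnn.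
  exact: computable_add.
have crow : computable (fun _ x => (ix_row (nfst x)./2).*2).
  by apply/cdouble/computable_fst/computable_half.
have cstage : computable (fun _ x => (ix_stage (nfst x)./2).*2.+1).
  apply/computable_succ/cdouble/computable_fst/computable_snd.
  exact: computable_half.
have c3 : computable (fun _ x => (nsnd x).+3) by do 3!apply: computable_succ.
exists gadget_transport; split.
- have [c cP] : computable (fun p x => ecode (nfst x) (nsnd x)
      (p (npair (ix_row (nfst x)./2).*2 (nsnd x).+3))
      (p (npair (ix_stage (nfst x)./2).*2.+1 (nsnd x).+3))).
    by apply: centry => //; apply/computable_oracle/computable_pair.
  exists c => p x px _; eexists; last by move=> n; exact: cP.
  move=> f; rewrite [ev _ _ _]gadget_ev.
  have := entryP f _ _ _ _ (px (query f ord0)) (px (query f ord_max)).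
  congr complex_rep; apply/funext => m.
  by rewrite /section !npairK half_code_diag.
- by exists COracle => p b pb _; exists p.
- have [cm cmP] := computable_const 2.
  have [cq cqP] : computable (fun _ x => if nsnd x == 0%N
      then (ix_row (nfst x)./2).*2 else (ix_stage (nfst x)./2).*2.+1).
    apply: computable_if => //.
    apply: (@eq_computable (fun _ x => 1 - nsnd x)%N).
      by move=> p x; case: (nsnd x).
    by apply: computable_sub => //; exact: computable_const.
  have [cth cthP] : exists cth, forall k, exists2 e, eval0 cth k (encode e) &
      forall p m, eval p e m (ecode k m (p (npair 0 m.+3)) (p (npair 1 m.+3))).
    have [|cth cthP] := @computable_smn (fun p x => ecode (nfst x) (nsnd x)
        (p (npair 0 (nsnd x).+3)) (p (npair 1 (nsnd x).+3))).
      by apply: centry => //; apply/computable_oracle/computable_pair => //;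
         exact: computable_const.
    exists cth => k; have [e ek eP] := cthP k; exists e => // p m.
    by have := eP p m; rewrite !npairK.
  exists cm, cq, cth => f; split=> [|i|]; first exact: cmP.
    have := cqP (fun=> 0%N) (npair (code_diag f) i).
    rewrite !npairK half_code_diag; congr eval0.
    by rewrite /= /query -val_eqE /=; case: eqP.
  have [e ek eP] := cthP (code_diag f); exists e => //.
  exists setT, (ttheta gadget_transport f); split=> // p v pv _.
  eexists; last by move=> m; exact: eP.
  exact: entryP (pv ord0) (pv ord_max).
Qed.

End Transport.

Lemma le_cont_raw (R : realType) (S P : problem R) : le_cont S P -> le_raw S P.
Proof. by move=> [t [_ ct _]]; exists t. Qed.

Lemma computable_real0 (R : realType) : computable_pt (@real_rep R) 0.
Proof.
have [c cP] := computable_const (qnat 0).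
exists c, (fun=> qnat 0); split=> [n|k]; first exact: cP.
by rewrite nuQ_qnat subrr normr0 invr_ge0 exprn_ge0.
Qed.

Unset Implicit Arguments.
Set Strict Implicit.

Theorem theorem6p2 (R : realType) (J : set R)
    (J_compact : compact J) (J_itv : is_interval J) (J_int : J° !=set0)
    (r : set (CC R) -> nat -> rat * rat) (r_approx : approximants J r)
    (eps : R) (eps_gt0 : 0 < eps) (eps_comp : computable_pt (@real_rep R) eps)
    (x0 : R) (Jx0 : J x0) (x0_comp : computable_pt (@real_rep R) x0)
    (r0_comp : computable_seq (@complex_rep R)
       (fun n => gauss R (r [set (x0%:C : CC R)] n))) :
  [/\ equiv_TTE (P_sigma J r) (P_sigma_eps J eps r),
      equiv_cont (P_sigma J r) (P_sigma_eps J eps r)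
    & equiv_raw (P_sigma J r) (P_sigma_eps J eps r)].
Proof.
have spec0 := @spectrum_diagP R.
have speceps a z := @pseudospectrum_diagP R eps a z eps_gt0.
have zero_comp := computable_real0 R.
have eps_ge0 := ltW eps_gt0.
have [c1 c2] : equiv_cont (P_sigma J r) (P_sigma_eps J eps r).
  split.
  - exact: (gadget_le_cont r_approx Jx0 (lexx 0) eps_ge0 spec0 speceps).
  - exact: (gadget_le_cont r_approx Jx0 eps_ge0 (lexx 0) speceps spec0).
split.
- split.
  + exact: (gadget_le_TTE r_approx Jx0 (lexx 0) eps_ge0 spec0 speceps).
  + exact: (gadget_le_TTE r_approx Jx0 eps_ge0 (lexx 0) speceps spec0).
- by [].
- by split; exact: le_cont_raw.
Qed.
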